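(* Let $n\ge1$ and let $m_1,\dots,m_{2n+2}$ be nonzero integers. Let $D$ be the (standard) diagram of the vertical rational link $m_1m_2\cdots m_{2n+2}$, whose associated signed plane graph is $\widehat{VF_n}$ as described in the context. Put $B=A^{-1}$, $d=-A^2-A^{-2}$, $X=-A^{-3}$, $Y=-A^{3}$. Then $$\langle m_1m_2\cdots m_{2n+2}\rangle=d^{-n-2}X_0^T\Big(\prod_{i=1}^nA_i\Big)J,$$ where $J=(1,1)^T$, the product is $A_1A_2\cdots A_n$, $$X_0^T=\big((X^{m_1}-A^{m_1})B^{m_2}d^2,\;A^{m_1}Y^{m_2}d^2+(X^{m_1}-A^{m_1})(Y^{m_2}-B^{m_2})\big),$$ and $$A_i=\begin{pmatrix}X^{m_{2i+1}}B^{m_{2i+2}}d & X^{m_{2i+1}}(Y^{m_{2i+2}}-B^{m_{2i+2}})d^{-1}\\ (X^{m_{2i+1}}-A^{m_{2i+1}})B^{m_{2i+2}}d & (X^{m_{2i+1}}-A^{m_{2i+1}})(Y^{m_{2i+2}}-B^{m_{2i+2}})d^{-1}+A^{m_{2i+1}}Y^{m_{2i+2}}d\end{pmatrix}.$$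
   Context: Signed plane graphs correspond to link diagrams via the medial graph: each edge of the signed plane graph becomes a crossing whose type is determined by the edge sign. Kauffman's polynomial $Q[G]\in\mathbb{Z}[A,B,d]$ of a signed graph is determined by $Q[E_n]=d^{n-1}$ ($E_n$ the edgeless graph on $n$ vertices); for a loop $e$: $Q[G]=(A+Bd)Q[G-e]$ if $s(e)=-$, $(Ad+B)Q[G-e]$ if $s(e)=+$; for a non-loop $e$: $Q[G]=AQ[G-e]+BQ[G/e]$ if $s(e)=-$, $BQ[G-e]+AQ[G/e]$ if $s(e)=+$. For a signed plane graph $H$ with link diagram $D(H)$, the Kauffman bracket is $\langle D(H)\rangle=Q[H]|_{B=A^{-1},\,d=-A^2-A^{-2}}\in\mathbb{Z}[A,A^{-1}]$. A chain of length $m$ (nonzero integer) between vertices $u,v$ is a path of $|m|$ edges from $u$ to $v$ through new vertices, all of sign $\mathrm{sgn}(m)$; a sheaf of width $m$ is $|m|$ parallel edges between $u$ and $v$, all of sign $\mathrm{sgn}(m)$. The graph $VF_n$ has vertices $u,v_0,\dots,v_n$, two parallel edges $e,f$ joining $u$ and $v_0$, and, for $i=1,\dots,n$, edges $v_{i-1}v_i$ and $uv_i$. $\widehat{VF_n}$ is obtained by replacing $e$ by a chain of length $m_1$, $f$ by a sheaf of width $m_2$, each $v_{i-1}v_i$ by a chain of length $m_{2i+1}$, and each $uv_i$ by a sheaf of width $m_{2i+2}$. The diagram of the vertical rational link $m_1\cdots m_{2n+2}$ is $D(\widehat{VF_n})$ for a plane embedding, so its Kauffman bracket equals $Q[\widehat{VF_n}]$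 evaluated at $B=A^{-1}$, $d=-A^2-A^{-2}$. *)

(* Defs.v *)
From HB Require Import structures.
From mathcomp Require Import all_boot all_order all_algebra fraction ring.
From mathcomp Require Import mpoly.

Set Implicit Arguments.
Unset Strict Implicit.
Unset Printing Implicit Defensive.

Import GRing.Theory.
Local Open Scope ring_scope.

(* Finite signed multigraphs; loops and repeated edges are allowed.  An edge  *)
(* is a triple (x, y, s); it is undirected (the order of x and y is           *)
(* immaterial) and s = true encodes the sign +, s = false the sign -.         *)
Record sgraph (T : eqType) := SGraph {
  verts : seq T;
  edges : seq (T * T * bool)
}.

Section SignedGraphs.
Variable T : eqType.
Implicit Types (G : sgraph T) (e : T * T * bool) (es : seq (T * T * bool)).

Definition is_loop e := e.1.1 == e.1.2.

Definition wf_sgraph G :=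
  uniq (verts G) &&
  all (fun e => (e.1.1 \in verts G) && (e.1.2 \in verts G)) (edges G).

Definition del_edge G e := SGraph (verts G) (rem e (edges G)).

Definition merge_vertex (x y z : T) := if z == y then x else z.

Definition map_edge (g : T -> T) e := (g e.1.1, g e.1.2, e.2).

(* G / e for a non-loop e = (x, y, s): y is identified with x. *)
Definition contract_edge G e :=
  SGraph (rem e.1.2 (verts G))
         (map (map_edge (merge_vertex e.1.1 e.1.2)) (rem e (edges G))).

End SignedGraphs.

Definition vA : {mpoly int[3]} := mpolyX int U_(inord 0 : 'I_3).
Definition vB : {mpoly int[3]} := mpolyX int U_(inord 1 : 'I_3).
Definition vd : {mpoly int[3]} := mpolyX int U_(inord 2 : 'I_3).

Definition loop_coef (s : bool) := if s then vA * vd + vB else vA + vB * vd.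
Definition del_coef (s : bool) := if s then vB else vA.
Definition contr_coef (s : bool) := if s then vA else vB.

(* The rules determining Kauffman's polynomial, for every choice of edge.     *)
Record kauffman_rules (T : eqType) (Q : sgraph T -> {mpoly int[3]}) : Prop := {
  kauffman_edgeless : forall G, wf_sgraph G -> edges G = [::] ->
    Q G = vd ^+ (size (verts G)).-1;
  kauffman_loop : forall G e, wf_sgraph G -> e \in edges G -> is_loop e ->
    Q G = loop_coef e.2 * Q (del_edge G e);
  kauffman_nonloop : forall G e, wf_sgraph G -> e \in edges G -> ~~ is_loop e ->
    Q G = del_coef e.2 * Q (del_edge G e) + contr_coef e.2 * Q (contract_edge G e)
}.

(* The recursion is run on the first edge of the list; k is a fuel parameter. *)
(* kauffman_Q_rules below shows that the result obeys the rules at any edge,  *)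
(* and kauffman_Q_unique that these rules determine it.                       *)
Fixpoint kauffman_rec (T : eqType) (k : nat) (G : sgraph T) : {mpoly int[3]} :=
  match k, edges G with
  | k'.+1, e :: _ =>
      if is_loop e then loop_coef e.2 * kauffman_rec k' (del_edge G e)
      else del_coef e.2 * kauffman_rec k' (del_edge G e)
           + contr_coef e.2 * kauffman_rec k' (contract_edge G e)
  | _, _ => vd ^+ (size (verts G)).-1
  end.

Definition kauffman_Q (T : eqType) (G : sgraph T) : {mpoly int[3]} :=
  kauffman_rec (size (edges G)) G.

Section KauffmanRules.
Variable T : eqType.
Implicit Types (G : sgraph T) (e f : T * T * bool) (es : seq (T * T * bool)).
Implicit Types (g h : T -> T).

Lemma wf_del_edge G e : wf_sgraph G -> wf_sgraph (del_edge G e).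
Proof.
case/andP=> uV /allP wE; rewrite /wf_sgraph uV; apply/allP=> f /mem_rem.
exact: wE.
Qed.

Lemma wf_contract_edge G e :
  wf_sgraph G -> e \in edges G -> ~~ is_loop e -> wf_sgraph (contract_edge G e).
Proof.
case/andP=> uV /allP wE eG ne; rewrite /wf_sgraph rem_uniq //=.
have /andP[xV yV] := wE _ eG.
have mV z : z \in verts G -> merge_vertex e.1.1 e.1.2 z \in rem e.1.2 (verts G).
  by rewrite /merge_vertex mem_rem_uniq // inE; case: ifPn => [_ _|-> //]; apply/andP.
by apply/allP=> _ /mapP[f /mem_rem/wE /andP[fx fy] ->] /=; rewrite !mV.
Qed.

(* Kauffman recursion with the accumulated vertex identification g and the    *)
(* number k of vertices kept separately.                                      *)
Let aux := fix aux (k : nat) (g : T -> T) es : {mpoly int[3]} :=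
  if es is e :: es' then
    if g e.1.1 == g e.1.2 then loop_coef e.2 * aux k g es'
    else del_coef e.2 * aux k g es'
         + contr_coef e.2 * aux k.-1 (merge_vertex (g e.1.1) (g e.1.2) \o g) es'
  else vd ^+ k.-1.

Let same_ker g h := forall x y, (g x == g y) = (h x == h y).

Let merge_ker (x y z t : T) :
  (merge_vertex x y z == merge_vertex x y t) =
  (z == t) || ((z == x) || (z == y)) && ((t == x) || (t == y)).
Proof.
rewrite /merge_vertex.
case: (eqVneq z y) => [->|zy]; case: (eqVneq t y) => [->|ty].
- by rewrite !eqxx.
- by rewrite (eq_sym x) orbT orbF.
- by rewrite orbT andbT orbF (negbTE zy).
rewrite !orbF; case: (eqVneq z x) => [->|_] /=; last by rewrite orbF.
by rewrite (eq_sym t) orbb.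
Qed.

Let merge_id (x y : T) : merge_vertex x y x = merge_vertex x y y.
Proof. by apply/eqP; rewrite merge_ker !eqxx !orbT. Qed.

Let merge_factor (x y z : T) g : g x = g y -> g (merge_vertex x y z) = g z.
Proof. by rewrite /merge_vertex => gxy; case: eqP => [->|]. Qed.

Let merge_merge_sub (a b c d z w : T) :
  let m x y u v := merge_vertex (merge_vertex x y u) (merge_vertex x y v)
                     \o merge_vertex x y in
  m a b c d z = m a b c d w -> m c d a b z = m c d a b w.
Proof.
move=> m; have mab : m c d a b a = m c d a b b by apply: merge_id.
have mcd : m c d a b c = m c d a b d by rewrite /m /= merge_id.
have mz u : m c d a b (m a b c d u) = m c d a b u.
  by rewrite {2}/m [LHS]merge_factor merge_factor // !merge_factor.
by move=> e; rewrite -mz e mz.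
Qed.

Let aux_ker es : forall k g h, same_ker g h -> aux k g es = aux k h es.
Proof.
elim: es => [|e es IH] k g h gh //=; rewrite gh !(IH _ _ _ gh).
case: ifP => // _; congr (_ + _ * _); apply: IH => z t /=.
by rewrite !merge_ker !gh.
Qed.

Let aux_map es : forall k g h, aux k g (map (map_edge h) es) = aux k (g \o h) es.
Proof. by elim: es => [|e es IH] k g h //=; rewrite !IH. Qed.

Let aux_swap k g e f es : aux k g (e :: f :: es) = aux k g (f :: e :: es).
Proof.
case: e f => [[a b] s] [[c d] t] /=.
case: (eqVneq (g a) (g b)) => [ab|nab]; case: (eqVneq (g c) (g d)) => [cd|ncd].
- by rewrite mulrCA.
- by rewrite ab eqxx mulrDr; congr (_ + _); rewrite mulrCA.
- by rewrite cd eqxx mulrDr; congr (_ + _); rewrite mulrCA.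
have mE : (merge_vertex (g c) (g d) (g a) == merge_vertex (g c) (g d) (g b)) =
          (merge_vertex (g a) (g b) (g c) == merge_vertex (g a) (g b) (g d)).
  rewrite !merge_ker (negbTE nab) (negbTE ncd) /= !(eq_sym _ (g c)) !(eq_sym _ (g d)).
  have h1 x : ~~ ((x == g a) && (x == g b)).
    by apply: contra nab => /andP[/eqP<- /eqP<-].
  have h2 x : ~~ ((g c == x) && (g d == x)).
    by apply: contra ncd => /andP[/eqP-> /eqP->].
  move: (h1 (g c)) (h1 (g d)) (h2 (g a)) (h2 (g b)).
  by case: (g c == g a); case: (g c == g b); case: (g d == g a); case: (g d == g b).
rewrite mE; case: ifP => [mT|_].
  have -> : aux k.-1 (merge_vertex (g c) (g d) \o g) es =
            aux k.-1 (merge_vertex (g a) (g b) \o g) es.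
    apply: aux_ker => z w /=; rewrite !merge_ker.
    move: mT ncd; rewrite merge_ker => /orP[/eqP->|]; first by rewrite eqxx.
    move=> /andP[/orP[]/eqP-> /orP[]/eqP->]; rewrite ?eqxx // => _.
    by rewrite (orbC (g z == g b)) (orbC (g w == g b)).
  by case: s; case: t; rewrite /loop_coef /del_coef /contr_coef; ring.
set u1 := aux k.-1.-1 _ es; set u2 := aux k.-1.-1 _ es.
suff -> : u1 = u2 by ring.
by apply: aux_ker => z w /=; apply/eqP/eqP; apply: merge_merge_sub.
Qed.

Let aux_rem k g e es : e \in es -> aux k g es = aux k g (e :: rem e es).
Proof.
elim: es k g => // f es IH k g; rewrite inE [rem _ _]/=.
case: (eqVneq e f) => [->|ef] //= ees; rewrite -/(aux k g (e :: f :: rem e es)) aux_swap.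
by rewrite /= !(IH _ _ ees).
Qed.

Let rec_aux k G : wf_sgraph G -> size (edges G) = k ->
  kauffman_rec k G = aux (size (verts G)) id (edges G).
Proof.
elim: k G => [|k IH] G wG /=; first by case: (edges G).
case E: (edges G) => [|e es] //= [sk].
have eG : e \in edges G by rewrite E mem_head.
have sD : size (edges (del_edge G e)) = k by rewrite /= E /= eqxx.
have sC : size (edges (contract_edge G e)) = k by rewrite size_map sD.
rewrite IH ?wf_del_edge //= E /= eqxx.
rewrite /is_loop; case: ifPn => // ne; congr (_ + _ * _).
have /andP[uV /allP/(_ _ eG)/andP[_ yV]] := wG.
by rewrite IH ?wf_contract_edge //= E /= eqxx aux_map size_rem.
Qed.

Let kauffman_QE G : wf_sgraph G ->
  kauffman_Q G = aux (size (verts G)) id (edges G).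
Proof. by move=> wG; apply: rec_aux. Qed.

Lemma kauffman_Q_rules : kauffman_rules (@kauffman_Q T).
Proof.
split=> [G wG E | G e wG eG le | G e wG eG ne].
- by rewrite kauffman_QE // E.
- rewrite !kauffman_QE ?wf_del_edge // (aux_rem _ _ eG) /=.
  by move: le; rewrite /is_loop => ->.
rewrite !kauffman_QE ?wf_del_edge ?wf_contract_edge // (aux_rem _ _ eG) /=.
have /andP[uV /allP/(_ _ eG)/andP[_ yV]] := wG.
by rewrite aux_map size_rem //; move: ne; rewrite /is_loop => /negbTE->.
Qed.

Lemma kauffman_Q_unique Q : kauffman_rules Q ->
  forall G, wf_sgraph G -> Q G = kauffman_Q G.
Proof.
case=> Q0 Ql Qn G; move: {2}(size _) (erefl (size (edges G))) => k.
have [K0 Kl Kn] := kauffman_Q_rules.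
elim: k G => [|k IH] G sk wG; first by rewrite Q0 ?K0 //; apply: size0nil.
case E: (edges G) sk => [|e es] // [sk].
have eG : e \in edges G by rewrite E mem_head.
have sD : size (edges (del_edge G e)) = k by rewrite /= E /= eqxx.
have sC : size (edges (contract_edge G e)) = k by rewrite size_map sD.
case: (boolP (is_loop e)) => le.
  by rewrite (Ql _ e) // (Kl _ e) // IH // wf_del_edge.
by rewrite (Qn _ e) // (Kn _ e) // !IH ?wf_del_edge ?wf_contract_edge.
Qed.

End KauffmanRules.

(* The field Q(A) = Frac(Z[A]), which contains Z[A, A^-1]; negative powers of *)
(* d do not make sense in the latter.                                         *)
Definition QA : fieldType := {fraction {poly int}}.

Definition qA : QA := tofrac ('X : {poly int}).
Definition qB : QA := qA^-1.
Definition qd : QA := - qA ^+ 2 - qA ^- 2.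
Definition qX : QA := - qA ^- 3.
Definition qY : QA := - qA ^+ 3.

(* <D(G)> for a plane embedding of G: the specialization B = A^-1,            *)
(* d = -A^2 - A^-2 of Q[G].                                                   *)
Definition kauffman_bracket (T : eqType) (G : sgraph T) : QA :=
  mmap intr (fun i : 'I_3 => nth 0 [:: qA; qB; qd] i) (kauffman_Q G).

(* A chain of length m from x to y through the new vertices w 0, w 1, ...     *)
Definition chain_inner (T : eqType) (w : nat -> T) (m : int) : seq T :=
  mkseq w `|m|%N.-1.

Definition chain (T : eqType) (x y : T) (w : nat -> T) (m : int) :
    seq (T * T * bool) :=
  [seq (e, 0 < m) | e <- zip (x :: chain_inner w m) (rcons (chain_inner w m) y)].

Definition sheaf (T : eqType) (x y : T) (m : int) : seq (T * T * bool) :=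
  nseq `|m|%N (x, y, 0 < m).

(* inl None is u, inl (Some i) is v_i, and inr (k, j) is the j-th new vertex  *)
(* of the chain of length m_k.                                                *)
Definition vf_vertex : eqType := (option nat + nat * nat)%type.
Definition vf_u : vf_vertex := inl None.
Definition vf_v (i : nat) : vf_vertex := inl (Some i).
Definition vf_new (k j : nat) : vf_vertex := inr (k, j).

Definition VF_hat (n : nat) (m : nat -> int) : sgraph vf_vertex :=
  SGraph
    (vf_u :: [seq vf_v i | i <- iota 0 n.+1]
       ++ flatten [seq chain_inner (vf_new (2 * i + 1)%N) (m (2 * i + 1)%N)
                  | i <- iota 0 n.+1])
    (chain vf_u (vf_v 0) (vf_new 1) (m 1%N)
       ++ sheaf vf_u (vf_v 0) (m 2%N)
       ++ flatten [seq chain (vf_v i.-1) (vf_v i) (vf_new (2 * i + 1)%N)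
                         (m (2 * i + 1)%N)
                       ++ sheaf vf_u (vf_v i) (m (2 * i + 2)%N)
                  | i <- iota 1 n]).

Lemma chain_ends (T : eqType) (x y : T) w m (e : T * T * bool) :
  e \in chain x y w m ->
  (e.1.1 \in x :: chain_inner w m) && (e.1.2 \in y :: chain_inner w m).
Proof.
case/mapP=> -[a b] abZ -> /=; apply/andP; split.
  have := map_f fst abZ; rewrite -/(unzip1 _) unzip1_zip //=.
  by rewrite size_rcons.
rewrite -mem_rcons; have := map_f snd abZ.
by rewrite -/(unzip2 _) unzip2_zip //= size_rcons.
Qed.

Lemma wf_VF_hat n m : wf_sgraph (VF_hat n m).
Proof.
have uV (i : nat) : (i <= n)%N -> vf_v i \in verts (VF_hat n m).
  by move=> le_in; rewrite inE mem_cat map_f ?orbT // mem_iota.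
have nV i x : (i <= n)%N ->
    x \in chain_inner (vf_new (2 * i + 1)%N) (m (2 * i + 1)%N) ->
    x \in verts (VF_hat n m).
  move=> le_in xi; rewrite inE mem_cat; apply/orP; right; apply/orP; right.
  by apply/flatten_mapP; exists i; rewrite ?mem_iota.
have cV i x y e : (i <= n)%N ->
    x \in verts (VF_hat n m) -> y \in verts (VF_hat n m) ->
    e \in chain x y (vf_new (2 * i + 1)%N) (m (2 * i + 1)%N) ->
    (e.1.1 \in verts (VF_hat n m)) && (e.1.2 \in verts (VF_hat n m)).
  move=> le_in xV yV /chain_ends/andP[]; rewrite !(in_cons _ (chain_inner _ _)).
  by case/predU1P=> [->|/(nV _ _ le_in)->]; case/predU1P=> [->|/(nV _ _ le_in)->];
    rewrite ?xV ?yV.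
have sV x y k e :
    x \in verts (VF_hat n m) -> y \in verts (VF_hat n m) -> e \in sheaf x y k ->
    (e.1.1 \in verts (VF_hat n m)) && (e.1.2 \in verts (VF_hat n m)).
  by move=> xV yV; rewrite mem_nseq => /andP[_ /eqP->] /=; rewrite xV yV.
have u0 : vf_u \in verts (VF_hat n m) by rewrite inE eqxx.
apply/andP; split; last first.
  apply/allP=> e; rewrite /= !mem_cat => /or3P[||].
  - by apply: (cV 0%N) => //; apply: uV.
  - by apply: sV => //; apply: uV.
  case/flatten_mapP=> i; rewrite mem_iota add1n ltnS => /andP[i_gt0 le_in].
  rewrite mem_cat => /orP[].
    by apply: cV => //; apply: uV; rewrite // (leq_trans (leq_pred _)).
  by apply: sV => //; apply: uV.
have flatN s x : x \in flatten [seq chain_inner (vf_new (2 * i + 1)%N)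
                                     (m (2 * i + 1)%N) | i <- s] ->
    exists i j, i \in s /\ x = vf_new (2 * i + 1)%N j.
  by case/flatten_mapP=> i si /mapP[j _ ->]; exists i, j.
rewrite /VF_hat; move: (iota 0 n.+1) (iota_uniq 0 n.+1) => s us.
rewrite /= cat_uniq map_inj_uniq ?us => [|i j [] //]; apply/and4P; split=> //.
- rewrite mem_cat; apply/norP; split; first by apply/mapP=> -[].
  by apply/negP=> /flatN[i [j []]].
- apply/hasPn=> x /flatN[i [j [_ ->]]]; by apply/mapP=> -[].
elim: s us => //= i s IH /andP[nis us].
rewrite cat_uniq IH // mkseq_uniq => [|j k [] //]; rewrite andbT /=.
apply/hasPn=> x /flatN[k [j [ks ->]]]; apply/mapP=> -[l _ [/eqP]].
by rewrite eqn_add2r eqn_mul2l /= => /eqP ki; rewrite -ki ks in nis.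
Qed.

Definition vec_X0 (m : nat -> int) : 'rV[QA]_2 :=
  \row_j (if j == 0
          then (qX ^ m 1%N - qA ^ m 1%N) * qB ^ m 2%N * qd ^+ 2
          else qA ^ m 1%N * qY ^ m 2%N * qd ^+ 2
               + (qX ^ m 1%N - qA ^ m 1%N) * (qY ^ m 2%N - qB ^ m 2%N)).

Definition mat_A (p q : int) : 'M[QA]_2 :=
  \matrix_(i, j)
    (if i == 0 then
       if j == 0 then qX ^ p * qB ^ q * qd
       else qX ^ p * (qY ^ q - qB ^ q) * qd^-1
     else
       if j == 0 then (qX ^ p - qA ^ p) * qB ^ q * qd
       else (qX ^ p - qA ^ p) * (qY ^ q - qB ^ q) * qd^-1
            + qA ^ p * qY ^ q * qd).

Definition vec_J : 'cV[QA]_2 := const_mx 1.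

(* Main.v *)
(** Over the field Q(A) the bracket can be normalized as
    [<G> = d^(|V| - 1) N(E)], where [N] depends on the edges only: a loop
    contributes a factor, and a non-loop edge gives
    [N(G) = b N(G - e) + (a / d) N(G / e)].  Such an [N] is invariant under
    injective renaming of vertices.  For [x <> y], a chain and a sheaf from [x]
    to [y] act as linear combinations of "x and y apart" and "x and y
    identified": a chain gives
    [d^-|m| ((X^m - A^m) apart + A^m identified)] and a sheaf
    [B^m apart + (Y^m - B^m) / d^2 identified].
    Stripping the blocks (chain [v_(i-1) v_i], sheaf [u v_i]) one at a time, the
    two values of the remaining tail, with [v_i] apart from or identified with
    [u], are transformed by the matrix [A_i] up to the factor [d^(|m_(2i+1)| + 1)];
    the first block acts by [X_0^T]. *)

From HB Require Import structures.
Require Import Defs.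
From mathcomp Require Import all_boot all_order all_algebra.
From mathcomp Require Import fraction mpoly ring.

Set Implicit Arguments.
Unset Strict Implicit.
Unset Printing Implicit Defensive.

Import GRing.Theory.
Local Open Scope ring_scope.

(** * Normalized bracket of an edge list *)

Section NormalizedBracket.
Variables (T : eqType) (F : fieldType) (a b : bool -> F) (d : F).
Implicit Types (x y z w : T) (s : bool) (e : T * T * bool).
Implicit Types (es : seq (T * T * bool)) (g h : T -> T).

(** An edge with a pendant end contributes [b s + a s / d] to [nbracket], which is this weight
    divided by [d]. *)
Definition bridge_weight s := a s + b s * d.
Definition loop_weight s := a s * d + b s.

(* [g] records the vertex identifications made by the contractions so far. *)
Fixpoint nbracket_along g es : F :=
  if es is e :: es' then
    if g e.1.1 == g e.1.2 then loop_weight e.2 * nbracket_along g es'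
    else b e.2 * nbracket_along g es'
         + a e.2 / d * nbracket_along
                         (merge_vertex (g e.1.1) (g e.1.2) \o g) es'
  else 1.

Definition nbracket es := nbracket_along id es.

Lemma nbracket_along_map g h es :
  nbracket_along g (map (map_edge h) es) = nbracket_along (g \o h) es.
Proof. by elim: es g h => [|e es IH] g h //=; rewrite !IH. Qed.

Lemma nbracket_cons e es :
  nbracket (e :: es) =
    if is_loop e then loop_weight e.2 * nbracket es
    else b e.2 * nbracket es
         + a e.2 / d * nbracket (map (map_edge (merge_vertex e.1.1 e.1.2)) es).
Proof. by rewrite /nbracket /= nbracket_along_map. Qed.

Definition ends es : seq T := flatten [seq [:: e.1.1; e.1.2] | e <- es].

Lemma ends_cat es1 es2 : ends (es1 ++ es2) = ends es1 ++ ends es2.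
Proof. by rewrite /ends map_cat flatten_cat. Qed.

Lemma ends_map g es : ends (map (map_edge g) es) = map g (ends es).
Proof. by elim: es => //= e es IH; rewrite -IH. Qed.

Lemma eq_in_map_edge g h es : {in ends es, g =1 h} ->
  map (map_edge g) es = map (map_edge h) es.
Proof.
elim: es => //= e es IH gh; rewrite IH => [|z zE]; last first.
  by apply: gh; rewrite !inE zE !orbT.
by rewrite /map_edge !gh // !inE eqxx ?orbT.
Qed.

Lemma map_edge_id es : map (map_edge id) es = es.
Proof. by rewrite map_id_in // => -[[]]. Qed.

Lemma map_merge_notin x y es : y \notin ends es ->
  map (map_edge (merge_vertex x y)) es = es.
Proof.
move=> yE; rewrite -[RHS]map_edge_id; apply: eq_in_map_edge => z zE.
by rewrite /merge_vertex; case: eqP => // zy; rewrite -zy zE in yE.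
Qed.

(** The recursion only compares ends, and [h] intertwines the merge of two ends with the merge of
    their images. *)
Lemma nbracket_map_inj h es : {in ends es &, injective h} ->
  nbracket (map (map_edge h) es) = nbracket es.
Proof.
(* Induction on the length, since the contracted list is not a tail of [es]. *)
have [k] := ubnP (size es); elim: k es h => // k IH [|e es] h //= sk hI.
have hI' : {in ends es &, injective h}.
  by move=> x y xE yE; apply: hI; rewrite !inE ?xE ?yE !orbT.
have xE : e.1.1 \in ends (e :: es) by rewrite inE eqxx.
have yE : e.1.2 \in ends (e :: es) by rewrite !inE eqxx orbT.
rewrite !nbracket_cons /is_loop /= (inj_in_eq hI) // IH //; case: eqP => // _.
congr (_ + _ * _); rewrite -[RHS](IH _ h) ?size_map //.
  congr nbracket; rewrite -!map_comp.
  apply: (@eq_in_map_edge (merge_vertex (h e.1.1) (h e.1.2) \o h)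
                          (h \o merge_vertex e.1.1 e.1.2)) => z zE /=.
  by rewrite /merge_vertex (inj_in_eq hI) ?(fun_if h) // !inE zE !orbT.
have mE z : z \in ends es -> merge_vertex e.1.1 e.1.2 z \in ends (e :: es).
  by rewrite /merge_vertex; case: eqP => // _ zE; rewrite !inE zE !orbT.
rewrite ends_map => _ _ /mapP[x xs ->] /mapP[y ys ->].
by apply: hI; apply: mE.
Qed.

(** As [x] is absent from the edges, the merge merely renames [y]. *)
Lemma nbracket_merge_fresh x y es : x \notin ends es ->
  nbracket (map (map_edge (merge_vertex x y)) es) = nbracket es.
Proof.
move=> xE; apply: nbracket_map_inj => z t zE tE; rewrite /merge_vertex.
have zx : z == x = false by apply: contraNF xE => /eqP <-.
have tx : t == x = false by apply: contraNF xE => /eqP <-.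
by case: eqP => [->|_]; case: eqP => [->|_] // /eqP; rewrite ?(eq_sym x) ?zx ?tx.
Qed.

Lemma nbracket_loops x s k es :
  nbracket (nseq k (x, x, s) ++ es) = loop_weight s ^+ k * nbracket es.
Proof.
elim: k => [|k IH] /=; first by rewrite expr0 mul1r.
by rewrite nbracket_cons /is_loop eqxx IH exprS mulrA.
Qed.

Lemma map_merge_sheaf x y s k :
  map (map_edge (merge_vertex x y)) (nseq k (x, y, s)) = nseq k (x, x, s).
Proof.
rewrite map_nseq /map_edge /= /merge_vertex eqxx.
by case: eqP => // <-.
Qed.

(** * Sheaves and chains *)

Hypothesis d_neq0 : d != 0.

(** Contracting one edge turns the others into loops; as [a s * d = loop_weight s - b s], the
    resulting geometric sum telescopes. *)
Lemma nbracket_sheaf x y s k es : x != y ->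
  nbracket (nseq k (x, y, s) ++ es) =
    b s ^+ k * nbracket es
    + (loop_weight s ^+ k - b s ^+ k) / d ^+ 2
      * nbracket (map (map_edge (merge_vertex x y)) es).
Proof.
move=> xy; elim: k => [|k IH] /=; first by rewrite subrr !mul0r addr0 mul1r.
rewrite nbracket_cons /is_loop /= (negbTE xy) IH map_cat map_merge_sheaf.
by rewrite nbracket_loops !exprS /loop_weight; field.
Qed.

Definition path_edges x ws y s : seq (T * T * bool) :=
  [seq (xy, s) | xy <- zip (x :: ws) (rcons ws y)].

Lemma path_edges_cons x w ws y s :
  path_edges x (w :: ws) y s = (x, w, s) :: path_edges w ws y s.
Proof. by []. Qed.

Lemma map_path_edges g x ws y s :
  map (map_edge g) (path_edges x ws y s) = path_edges (g x) (map g ws) (g y) s.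
Proof. by elim: ws x => //= w ws IH x; rewrite !path_edges_cons -IH. Qed.

(** Deleting the first edge leaves a path pendant at [w], worth a pure power of
    [bridge_weight s / d]; contracting it leaves a shorter path from [x]. *)
Lemma nbracket_path x ws y s es :
  uniq (x :: y :: ws) -> {in ws, forall w, w \notin ends es} ->
  nbracket (path_edges x ws y s ++ es) =
    d ^- (size ws).+1
    * ((bridge_weight s ^+ (size ws).+1 - a s ^+ (size ws).+1) * nbracket es
       + a s ^+ (size ws).+1
         * nbracket (map (map_edge (merge_vertex x y)) es)).
Proof.
elim: ws x => [|w ws IH] x uE wE.
  move: uE; rewrite /= inE andbT => xy.
  rewrite nbracket_cons /is_loop /= (negbTE xy) !expr1 /bridge_weight.
  by field.
move: (uE); rewrite [uniq _]/= !inE !negb_or -!andbA.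
case/and4P=> xy xw xs /and4P[yw ys ws' us].
have wy : w != y by rewrite eq_sym.
have uw : uniq (w :: y :: ws) by rewrite /= inE negb_or wy ws' ys us.
have ux : uniq (x :: y :: ws) by rewrite /= inE negb_or xy xs ys us.
have wE' : {in ws, forall w', w' \notin ends es}.
  by move=> w' w's; apply: wE; rewrite inE w's orbT.
have wN : w \notin ends es by apply: wE; rewrite mem_head.
have mp : map (map_edge (merge_vertex x w)) (path_edges w ws y s) =
          path_edges x ws y s.
  rewrite map_path_edges {1}/merge_vertex eqxx /merge_vertex eq_sym (negbTE wy).
  congr path_edges; apply: map_id_in => z zs; case: eqP => // zw.
  by move: uw; rewrite /= inE -zw zs orbT.
rewrite path_edges_cons cat_cons nbracket_cons /is_loop /= (negbTE xw).
rewrite map_cat mp (map_merge_notin _ wN) !IH // nbracket_merge_fresh //.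
by rewrite !(exprS _ (size ws).+1) /bridge_weight; field; rewrite expf_neq0.
Qed.

Lemma nbracket_chain x y (w : nat -> T) (p : int) es : p != 0 -> x != y ->
  injective w -> (forall j, w j != x) -> (forall j, w j != y) ->
  (forall j, w j \notin ends es) ->
  let s := 0 < p in let k := `|p|%N in
  nbracket (chain x y w p ++ es) =
    d ^- k * ((bridge_weight s ^+ k - a s ^+ k) * nbracket es
              + a s ^+ k * nbracket (map (map_edge (merge_vertex x y)) es)).
Proof.
move=> p0 xy wI wx wy wE s k.
(* Here [p != 0] matters: at zero the truncated predecessor would still give a chain of one edge. *)
have kE : k = (size (chain_inner w p)).+1 by rewrite size_mkseq prednK ?absz_gt0.
rewrite kE -nbracket_path //.
  rewrite /= mkseq_uniq // inE negb_or xy /= andbT; apply/andP; split.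
    by apply/mapP=> -[j _ xj]; move: (wx j); rewrite xj eqxx.
  by apply/mapP=> -[j _ yj]; move: (wy j); rewrite yj eqxx.
by move=> _ /mapP[j _ ->].
Qed.

End NormalizedBracket.

(** * Stripping blocks off the fan *)

Section Fan.
Variables (F : fieldType) (a b : bool -> F) (d : F) (m : nat -> int).
Hypothesis d_neq0 : d != 0.
Local Notation nbr := (nbracket a b d).

(** The start [x] varies: it is [vf_u] for the first block and after an identification, [vf_v i.-1]
    otherwise. *)
Definition vf_block (x : vf_vertex) (i : nat) :=
  chain x (vf_v i) (vf_new (2 * i + 1)) (m (2 * i + 1))
  ++ sheaf vf_u (vf_v i) (m (2 * i + 2)).

Definition vf_tail (i k : nat) :=
  flatten [seq vf_block (vf_v j.-1) j | j <- iota i k].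

(** A superset of the vertices met after block [i], as a boolean test so that freshness follows by
    computation. *)
Definition vf_from (i : nat) (z : vf_vertex) : bool :=
  match z with
  | inl None => true
  | inl (Some j) => (i <= j)%N
  | inr (k, _) => (2 * i + 1 < k)%N
  end.

Lemma ends_vf_tail i k z : z \in ends (vf_tail i.+1 k) -> vf_from i z.
Proof.
case/flatten_mapP=> e /flatten_mapP[j]; rewrite mem_iota => /andP[ij _] eB.
have inner w : w \in chain_inner (vf_new (2 * j + 1)) (m (2 * j + 1)) -> vf_from i w.
  by case/mapP=> l _ -> /=; rewrite ltn_add2r ltn_mul2l.
have vj : vf_from i (vf_v j) by apply: ltnW.
have vj1 : vf_from i (vf_v j.-1) by rewrite /= -ltnS (leq_trans ij) // leqSpred.
move: eB; rewrite mem_cat => /orP[/chain_ends/andP[]|].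
  rewrite !(in_cons _ (chain_inner _ _)).
  by move=> /predU1P[->|/inner ex] /predU1P[->|/inner ey]; rewrite !inE => /orP[]/eqP->.
by rewrite mem_nseq => /andP[_ /eqP->]; rewrite !inE => /orP[]/eqP->.
Qed.

Lemma nbracket_vf_block x i k (p := m (2 * i + 1)) : p != 0 ->
  x != vf_v i -> (forall j, vf_new (2 * i + 1) j != x) ->
  let s := 0 < p in
  let es := sheaf vf_u (vf_v i) (m (2 * i + 2)) ++ vf_tail i.+1 k in
  nbr (vf_block x i ++ vf_tail i.+1 k) =
    d ^- `|p|%N
    * ((bridge_weight a b d s ^+ `|p|%N - a s ^+ `|p|%N) * nbr es
       + a s ^+ `|p|%N * nbr (map (map_edge (merge_vertex x (vf_v i))) es)).
Proof.
move=> p0 xv wx s es; rewrite -catA nbracket_chain // => [j l [] //|j].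
rewrite ends_cat mem_cat negb_or; apply/andP; split; last first.
  by apply/negP=> /ends_vf_tail /=; rewrite ltnn.
by apply/negP=> /flatten_mapP[e]; rewrite mem_nseq => /andP[_ /eqP->]; rewrite !inE.
Qed.

Definition apart_tail i k := nbr (vf_tail i.+1 k).
Definition joined_tail i k :=
  nbr (map (map_edge (merge_vertex vf_u (vf_v i))) (vf_tail i.+1 k)).

Lemma nbracket_sheaf_tail i k (q := m (2 * i + 2)) (s := 0 < q) :
  nbr (sheaf vf_u (vf_v i) q ++ vf_tail i.+1 k) =
    b s ^+ `|q|%N * apart_tail i k
    + (loop_weight a b d s ^+ `|q|%N - b s ^+ `|q|%N) / d ^+ 2 * joined_tail i k.
Proof. exact: nbracket_sheaf. Qed.

(** Identifying the ends of the chain turns the sheaf into loops, whence the last factor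
    [loop_weight]. *)
Lemma nbracket_joined_block i k
    (p := m (2 * i + 1)) (q := m (2 * i + 2)) (s := 0 < p) (t := 0 < q) :
  p != 0 ->
  nbr (vf_block vf_u i ++ vf_tail i.+1 k) =
    d ^- `|p|%N
    * ((bridge_weight a b d s ^+ `|p|%N - a s ^+ `|p|%N)
         * (b t ^+ `|q|%N * apart_tail i k
            + (loop_weight a b d t ^+ `|q|%N - b t ^+ `|q|%N) / d ^+ 2
              * joined_tail i k)
       + a s ^+ `|p|%N * (loop_weight a b d t ^+ `|q|%N * joined_tail i k)).
Proof.
move=> p0; rewrite nbracket_vf_block //= nbracket_sheaf_tail map_cat.
by rewrite map_merge_sheaf nbracket_loops.
Qed.

Lemma vf_tailS i k :
  vf_tail i.+1 k.+1 = vf_block (vf_v i) i.+1 ++ vf_tail i.+2 k.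
Proof. by []. Qed.

Lemma vf_v_notin i k : vf_v i \notin ends (vf_tail i.+2 k).
Proof. by apply/negP=> /ends_vf_tail /=; rewrite ltnn. Qed.

Lemma vf_v_notin_sheaf i q : vf_v i \notin ends (sheaf vf_u (vf_v i.+1) q).
Proof.
apply/negP=> /flatten_mapP[e]; rewrite mem_nseq => /andP[_ /eqP->].
by rewrite !inE => /orP[]/eqP // [] /eqP; rewrite ltn_eqF.
Qed.

(* The vertex v_i meets nothing else in the tail, so the chain leaving it is
   pendant: contracting or deleting it gives the same normalized bracket. *)
Lemma apart_tailS i k (p := m (2 * i.+1 + 1)) (q := m (2 * i.+1 + 2))
    (s := 0 < p) (t := 0 < q) :
  p != 0 ->
  apart_tail i k.+1 =
    d ^- `|p|%N * (bridge_weight a b d s ^+ `|p|%N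
    * (b t ^+ `|q|%N * apart_tail i.+1 k
       + (loop_weight a b d t ^+ `|q|%N - b t ^+ `|q|%N) / d ^+ 2
         * joined_tail i.+1 k)).
Proof.
move=> p0; rewrite /apart_tail vf_tailS nbracket_vf_block //=; last first.
  by apply/eqP=> -[] /eqP; rewrite ltn_eqF.
rewrite nbracket_merge_fresh; last first.
  by rewrite ends_cat mem_cat negb_or vf_v_notin vf_v_notin_sheaf.
by rewrite -mulrDl subrK nbracket_sheaf_tail.
Qed.

(** The tail meets [vf_v i] only at the start of its first chain, so the merge just moves that start
    to [vf_u]. *)
Lemma joined_tailS i k :
  joined_tail i k.+1 = nbr (vf_block vf_u i.+1 ++ vf_tail i.+2 k).
Proof.
rewrite /joined_tail vf_tailS; congr nbracket.
rewrite map_cat (map_merge_notin _ (vf_v_notin i k)); congr (_ ++ _).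
rewrite map_cat (map_merge_notin _ (vf_v_notin_sheaf i _)); congr (_ ++ _).
rewrite [LHS]map_path_edges /merge_vertex eqxx.
have -> : (vf_v i.+1 == vf_v i) = false by apply/eqP=> -[] /eqP; rewrite gtn_eqF.
by congr path_edges; apply: map_id_in => z /mapP[j _ ->].
Qed.

End Fan.

(** * Specialization to Q(A) *)

Definition qa (s : bool) : QA := if s then qA else qB.
Definition qb (s : bool) : QA := if s then qB else qA.

Section Identities.
Variables (F : fieldType) (A : F).
Hypothesis A_neq0 : A != 0.

Lemma bridge_identity : A + A^-1 * (- A ^+ 2 - A ^- 2) = - A ^- 3.
Proof. by field. Qed.

Lemma loop_identity : A * (- A ^+ 2 - A ^- 2) + A^-1 = - A ^+ 3.
Proof. by field. Qed.

Lemma d_identity : A ^+ 4 + 1 = - (A ^+ 2 * (- A ^+ 2 - A ^- 2)).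
Proof. by field. Qed.

Lemma contract_identity (d D a b W W' : F) : d != 0 ->
  b * (d * D * W) + a * (D * W') = d * D * (b * W + a / d * W').
Proof. by move=> d_neq0; field. Qed.

(** In this and the next two identities [x], [y], [a], [b] stand for powers of X, Y, A, B, and [P],
    [C] for the apart and joined values of the tail. The left side here is the first row of [mat_A]
    applied to them. *)
Lemma apart_identity (k : nat) (d x y b P C : F) : d != 0 ->
  x * b * d * P + x * (y - b) / d * C =
    d ^+ k.+1 * (d ^- k * (x * (b * P + (y - b) / d ^+ 2 * C))).
Proof. by move=> d_neq0; rewrite (exprS d k); field; rewrite d_neq0 expf_neq0. Qed.

Lemma joined_identity (k : nat) (d x y a b P C : F) : d != 0 ->
  (x - a) * b * d * P + ((x - a) * (y - b) / d + a * y * d) * C =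
    d ^+ k.+1 * (d ^- k * ((x - a) * (b * P + (y - b) / d ^+ 2 * C)
                           + a * (y * C))).
Proof. by move=> d_neq0; rewrite (exprS d k); field; rewrite d_neq0 expf_neq0. Qed.

Lemma transfer_identity (k l n : nat) (d x y a b P C : F) : d != 0 ->
  d ^+ (k + l)
  * (d ^- k * ((x - a) * (b * P + (y - b) / d ^+ 2 * C) + a * (y * C))) =
    d ^- (n + 2)
    * (d ^+ (l + n) * ((x - a) * b * d ^+ 2 * P
                       + (a * y * d ^+ 2 + (x - a) * (y - b)) * C)).
Proof.
by move=> d_neq0; rewrite !exprD; field; rewrite d_neq0 !expf_neq0.
Qed.

End Identities.

Lemma qA_neq0 : qA != 0.
Proof. by rewrite tofrac_eq0 polyX_eq0. Qed.

(** If d vanished, so would the polynomial X^4 + 1, whose value at 0 is 1. *)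
Lemma qd_neq0 : qd != 0.
Proof.
suff: qA ^+ 4 + 1 != 0.
  apply: contra => /eqP d0; rewrite (d_identity qA_neq0) -[X in _ * X]/qd.
  by rewrite d0 mulr0 oppr0.
have -> : qA ^+ 4 + 1 = tofrac ('X^4 + 1 : {poly int}).
  by rewrite rmorphD rmorphXn rmorph1.
rewrite tofrac_eq0; apply/eqP=> /(congr1 (horner^~ 0)).
by rewrite !hornerE => /eqP.
Qed.

Lemma exprz_sign (F : fieldType) (x y : F) (p : int) : x^-1 = y ->
  (if 0 < p then x else y) ^+ `|p|%N = x ^ p.
Proof. by move=> <-; case: p => [[|k]|k] //=; rewrite NegzE -exprnN exprVn. Qed.

Lemma qa_expr p : qa (0 < p) ^+ `|p|%N = qA ^ p.
Proof. exact: exprz_sign. Qed.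

Lemma qb_expr p : qb (0 < p) ^+ `|p|%N = qB ^ p.
Proof. by apply: exprz_sign; rewrite invrK. Qed.

(** Changing the sign of an edge swaps A and B, hence turns X = A + B d into Y = B + A d, which is
    the inverse of X. *)
Lemma bridge_weight_expr p : bridge_weight qa qb qd (0 < p) ^+ `|p|%N = qX ^ p.
Proof.
rewrite -(@exprz_sign _ qX qY) ?invrN ?invrK //; congr (_ ^+ _).
case: ifP => _; first exact: (bridge_identity qA_neq0).
by rewrite /bridge_weight addrC; apply: (loop_identity qA_neq0).
Qed.

Lemma loop_weight_expr p : loop_weight qa qb qd (0 < p) ^+ `|p|%N = qY ^ p.
Proof.
rewrite -(@exprz_sign _ qY qX) ?invrN ?invrK //; congr (_ ^+ _).
case: ifP => _; first exact: (loop_identity qA_neq0).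
by rewrite /loop_weight addrC; apply: (bridge_identity qA_neq0).
Qed.

Definition specialize : {mpoly int[3]} -> QA :=
  mmap intr (fun i : 'I_3 => nth 0 [:: qA; qB; qd] i).

HB.instance Definition _ := GRing.RMorphism.copy specialize
  (mmap intr (fun i : 'I_3 => nth 0 [:: qA; qB; qd] i)).

Lemma specialize_var k : (k < 3)%N ->
  specialize (mpolyX int U_(inord k : 'I_3)) = nth 0 [:: qA; qB; qd] k.
Proof. by move=> k3; rewrite /specialize mmapX mmap1U inordK. Qed.

(** Deletion keeps the vertices and contraction loses one, which the division in [a e.2 / d]
    compensates. *)
Lemma kauffman_bracketE (T : eqType) (G : sgraph T) : wf_sgraph G ->
  kauffman_bracket G = qd ^+ (size (verts G)).-1 * nbracket qa qb qd (edges G).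
Proof.
have eA : specialize vA = qA by rewrite specialize_var.
have eB : specialize vB = qB by rewrite specialize_var.
have ed : specialize vd = qd by rewrite specialize_var.
rewrite /kauffman_bracket -/(specialize _).
have [Q0 Ql Qn] := kauffman_Q_rules T.
move: {2}(size _) (erefl (size (edges G))) => k.
elim: k G => [|k IH] G sk wG.
  by rewrite Q0 ?(size0nil sk) // rmorphXn /= ed mulr1.
case E: (edges G) sk => [|e es] // [sk].
have eG : e \in edges G by rewrite E mem_head.
have eD : edges (del_edge G e) = es by rewrite /= E /= eqxx.
have sD : size (edges (del_edge G e)) = k by rewrite eD.
have eC : edges (contract_edge G e) =
    map (map_edge (merge_vertex e.1.1 e.1.2)) es by rewrite /= E /= eqxx.
have sC : size (edges (contract_edge G e)) = k by rewrite eC size_map.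
rewrite nbracket_cons; case: ifPn => le.
  rewrite (Ql _ e) // rmorphM /= IH ?wf_del_edge // eD /=.
  rewrite [RHS]mulrCA; congr (_ * _); rewrite /loop_coef /loop_weight /qa /qb.
  by case: e.2; rewrite rmorphD rmorphM /= eA eB ed // addrC.
rewrite (Qn _ e) // rmorphD !rmorphM /=.
rewrite !IH ?wf_del_edge ?wf_contract_edge // eD eC /=.
have /andP[uV /allP/(_ _ eG)/andP[xV yV]] := wG.
(* The surviving end shows that the contracted graph has a vertex, so the predecessor below does not
   truncate. *)
have xR : e.1.1 \in rem e.1.2 (verts G) by rewrite mem_rem_uniq // !inE xV andbT.
have -> : (size (verts G)).-1 = (size (rem e.1.2 (verts G))).-1.+1.
  by rewrite -(size_rem yV); case: (rem _ _) xR.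
have -> : specialize (del_coef e.2) = qb e.2 by rewrite /del_coef /qb; case: e.2.
have -> : specialize (contr_coef e.2) = qa e.2 by rewrite /contr_coef /qa; case: e.2.
rewrite exprS; exact: (contract_identity _ _ _ _ _ qd_neq0).
Qed.

(** * Transfer matrices *)

Definition tail_col m i k : 'cV[QA]_2 :=
  \col_j (if j == 0 then apart_tail qa qb qd m i k else joined_tail qa qb qd m i k).

(** The chain accounts for its length in the exponent; the extra [qd] is the factor by which the
    entries of [mat_A] exceed the coefficients of the block. *)
Lemma mat_A_tail_col (m : nat -> int) i k : m (2 * i.+1 + 1)%N != 0 ->
  mat_A (m (2 * i.+1 + 1)%N) (m (2 * i.+1 + 2)%N) *m tail_col m i.+1 k =
    qd ^+ (`|m (2 * i.+1 + 1)|%N).+1 *: tail_col m i k.+1.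
Proof.
move=> p0; apply/colP=> j; rewrite !mxE !big_ord_recl big_ord0 !mxE /=.
rewrite joined_tailS nbracket_joined_block ?apart_tailS ?qd_neq0 //.
rewrite !bridge_weight_expr !loop_weight_expr !qa_expr !qb_expr addr0.
case: ifP => _; first exact: (apart_identity _ _ _ _ _ _ qd_neq0).
exact: (joined_identity _ _ _ _ _ _ _ qd_neq0).
Qed.

(** Both values of an empty tail are 1, so [vec_J] is its [tail_col]; each matrix then prepends a
    block. *)
Lemma prod_mat_A_J m i k : (forall j, (i < j <= i + k)%N -> m (2 * j + 1)%N != 0) ->
  (\prod_(j <- iota i.+1 k) mat_A (m (2 * j + 1)%N) (m (2 * j + 2)%N)) *m vec_J =
    qd ^+ (\sum_(j <- iota i.+1 k) `|m (2 * j + 1)%N|%N.+1) *: tail_col m i k.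
Proof.
elim: k i => [|k IH] i m0.
  by rewrite !big_nil scale1r mul1mx; apply/colP=> j; rewrite !mxE; case: ifP.
rewrite /= !big_cons -mulmxA IH => [|j /andP[ij jk]]; last first.
  by apply: m0; rewrite (ltn_trans _ ij) //= addnS -addSn.
rewrite -scalemxAr mat_A_tail_col; last first.
  by apply: m0; rewrite ltnSn addnS ltnS leq_addr.
by rewrite scalerA -exprD addnC.
Qed.

(** Each [vf_v i] together with the inner vertices of its chain counts for the chain length; the
    predecessor discards [vf_u]. *)
Lemma size_verts_VF_hat n m :
  (forall i, (i <= n)%N -> m (2 * i + 1)%N != 0) ->
  (size (verts (VF_hat n m))).-1 = (\sum_(i <- iota 0 n.+1) `|m (2 * i + 1)|)%N.
Proof.
move=> m0; rewrite /VF_hat; move: (iota 0 n.+1) (mem_iota 0 n.+1) => r rE.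
rewrite /= size_cat size_map size_flatten sumnE.
rewrite /shape !big_map -sum1_size -big_split /=.
rewrite big_seq [RHS]big_seq; apply: eq_bigr => i; rewrite rE => /m0 mi.
by rewrite size_mkseq add1n prednK // absz_gt0.
Qed.

Theorem theorem12 (n : nat) (m : nat -> int) (n_ge1 : (1 <= n)%N)
    (m_neq0 : forall i : nat, (1 <= i <= 2 * n + 2)%N -> m i != 0) :
  kauffman_bracket (VF_hat n m) =
    qd ^ (- n%:Z - 2)
    * (vec_X0 m
       *m (\prod_(1 <= i < n.+1) mat_A (m (2 * i + 1)%N) (m (2 * i + 2)%N))
       *m vec_J) 0 0.
Proof.
have m0 i : (i <= n)%N -> m (2 * i + 1)%N != 0.
  by move=> le_in; apply: m_neq0; rewrite addn1 addn2 /= ltnS leqW // leq_mul2l.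
rewrite kauffman_bracketE ?wf_VF_hat // size_verts_VF_hat //.
(* The replacements of e and f form block 0, started at [vf_u]. *)
have -> : edges (VF_hat n m) = vf_block m vf_u 0 ++ vf_tail m 1 n by rewrite -catA.
rewrite nbracket_joined_block ?m0 ?qd_neq0 // -mulmxA /index_iota subn1.
rewrite prod_mat_A_J; last first.
  by move=> j /andP[_ jn]; apply: m0.
rewrite -scalemxAr !mxE !big_ord_recl big_ord0 !mxE /=.
rewrite !bridge_weight_expr !loop_weight_expr !qa_expr !qb_expr addr0.
(* One surplus [qd] per matrix and the [qd ^+ 2] carried by [vec_X0] are what the prefactor of
   exponent -n - 2 cancels. *)
have -> : (\sum_(j <- iota 1 n) `|m (2 * j + 1)|.+1 =
           \sum_(j <- iota 1 n) `|m (2 * j + 1)| + n)%N.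
  by under eq_bigr do rewrite -addn1; rewrite big_split sum1_size size_iota.
have -> : - n%:Z - 2 = - (n + 2)%N%:Z by rewrite PoszD natz opprD.
rewrite big_cons -exprnN; exact: (transfer_identity _ _ _ _ _ _ _ _ _ qd_neq0).
Qed.
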